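(* Let $G=(V,E,A)$ be an attributed graph with exactly two attribute values, $A_{val}=\{a_1,a_2\}$, equipped with a fixed proper vertex coloring, and let $k$ be an integer (and $\delta$ an integer). Then any relative fair clique of $G$ (with parameters $k$ and $\delta$) is contained in the enhanced colorful $(k-1)$-core of $G$.
   Context: An attributed graph $G=(V,E,A)$ is a finite undirected, unweighted graph in which each vertex $u$ carries an attribute value $u.val$; $A_{val}=\{u.val : u\in V\}$. The vertices of $G$ are colored so that no two adjacent vertices have the same color. Subgraphs inherit attribute values and colors from $G$. Relative fair clique: given integers $k,\delta$, a clique $C$ of $G$ is a relative fair clique if (1) for each $a_i\in A_{val}$, the number $cnt_C(a_i)$ of vertices of $C$ with attribute value $a_i$ is at least $k$; (2) $|cnt_C(a_i)-cnt_C(a_j)|\le\delta$ for all $a_i,a_j\in A_{val}$; and (3) there is no clique $C'\supsetneq C$ satisfying (1) and (2). Enhanced colorful degree with target $t$: let $u$ be a vertex of a subgraph $H$ of $G$. Partition the neighbors of $u$ in $H$ into groups, each consisting of all neighbors having one given color. Let $c_1$ be the number of groups containing only vertices of attribute $a_1$, $c_2$ the number of groups containing only vertices of attribute $a_2$, and $c_m$ the number of mixed groups (containing vertices of both attributes). Assign mixed groups as follows: if $c_1<t$, assign $\min\{c_m,\,t-c_1\}$ of the mixed groups to $a_1$; then, if $c_2<t$, assign $\min\{c_m',\,t-c_2\}$ of the remaining $c_m'$ mixed groups to $a_2$. The enhanced colorful degree $ED(u)$ is the minimum of the resulting number of groups belonging to $a_1$ and the resulting number of groups belonging to $a_2$ (pure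 groups plus assigned mixed groups). Enhanced colorful $t$-core: a subgraph $H=(V_H,E_H,A)$ of $G$ is an enhanced colorful $t$-core if (1) $ED(u)\ge t$ for each $u\in V_H$, with $ED$ computed in $H$ with target $t$; and (2) there is no subgraph $H'\subseteq G$ satisfying (1) with $H\subsetneq H'$. *)

(* Defs.v *)
From HB Require Import structures.
From mathcomp Require Import all_boot all_order all_algebra.
Set Implicit Arguments.
Unset Strict Implicit.
Unset Printing Implicit Defensive.
Import Order.TTheory GRing.Theory Num.Theory.
Local Open Scope ring_scope.

(* Finite simple undirected graphs with vertices drawn from T; an edge is a
   two-element set of vertices. The same type serves for the ambient graph and
   for its (not necessarily induced) subgraphs. *)
Record graph (T : finType) := Graph {
  vertices : {set T};
  edges : {set {set T}};
  edgesP : [forall e in edges, (#|e| == 2%N) && (e \subset vertices)]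
}.

Definition adjacent (T : finType) (G : graph T) (u v : T) : bool :=
  [set u; v] \in edges G.

Definition neighbors (T : finType) (G : graph T) (u : T) : {set T} :=
  [set v | adjacent G u v].

Definition subgraph (T : finType) (H G : graph T) : Prop :=
  vertices H \subset vertices G /\ edges H \subset edges G.

Definition proper_subgraph (T : finType) (H G : graph T) : Prop :=
  subgraph H G /\ H <> G.

(* Cliques are complete subgraphs; the empty graph counts as one. *)
Definition clique (T : finType) (G C : graph T) : Prop :=
  subgraph C G /\
  {in vertices C &, forall u v, u != v -> adjacent C u v}.

Definition proper_coloring (T : finType) (Col : eqType) (G : graph T)
    (color : T -> Col) : Prop :=
  forall u v, adjacent G u v -> color u != color v.

Definition attribute_values (T : finType) (Attr : eqType) (G : graph T)
    (attr : T -> Attr) : seq Attr :=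
  [seq attr u | u in vertices G].

Definition cnt (T : finType) (Attr : eqType) (attr : T -> Attr) (C : graph T)
    (a : Attr) : nat :=
  #|[set u in vertices C | attr u == a]|.

Definition fair (T : finType) (Attr : eqType) (G : graph T)
    (attr : T -> Attr) (k delta : int) (C : graph T) : Prop :=
  {in attribute_values G attr, forall a, k <= (cnt attr C a)%:Z} /\
  {in attribute_values G attr &, forall a b,
     `|(cnt attr C a)%:Z - (cnt attr C b)%:Z| <= delta}.

Definition relative_fair_clique (T : finType) (Attr : eqType) (G : graph T)
    (attr : T -> Attr) (k delta : int) (C : graph T) : Prop :=
  [/\ clique G C,
      fair G attr k delta C
    & ~ exists C' : graph T,
        [/\ clique G C', fair G attr k delta C' & proper_subgraph C C']].

Definition color_groups (T : finType) (Col : eqType) (color : T -> Col)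
    (H : graph T) (u : T) : {set {set T}} :=
  preim_partition color (neighbors H u).

(* Color groups are non-empty, so the universal quantification is not vacuous. *)
Definition pure_groups (T : finType) (Attr Col : eqType) (attr : T -> Attr)
    (color : T -> Col) (H : graph T) (u : T) (a : Attr) : nat :=
  #|[set B in color_groups color H u | [forall v in B, attr v == a]]|.

Definition mixed_groups (T : finType) (Attr Col : eqType) (attr : T -> Attr)
    (color : T -> Col) (H : graph T) (u : T) (a1 a2 : Attr) : nat :=
  #|[set B in color_groups color H u |
      [exists v in B, attr v == a1] && [exists v in B, attr v == a2]]|.

Definition enhanced_colorful_degree (T : finType) (Attr Col : eqType)
    (attr : T -> Attr) (color : T -> Col) (a1 a2 : Attr) (t : int)
    (H : graph T) (u : T) : int :=
  let c1 := (pure_groups attr color H u a1)%:Z in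
  let c2 := (pure_groups attr color H u a2)%:Z in
  let cm := (mixed_groups attr color H u a1 a2)%:Z in
  let m1 := if c1 < t then Num.min cm (t - c1) else 0 in
  let m2 := if c2 < t then Num.min (cm - m1) (t - c2) else 0 in
  Num.min (c1 + m1) (c2 + m2).

Definition min_enhanced_degree (T : finType) (Attr Col : eqType)
    (attr : T -> Attr) (color : T -> Col) (a1 a2 : Attr) (t : int)
    (H : graph T) : Prop :=
  {in vertices H,
    forall u, t <= enhanced_colorful_degree attr color a1 a2 t H u}.

Definition enhanced_colorful_core (T : finType) (Attr Col : eqType)
    (G : graph T) (attr : T -> Attr) (color : T -> Col) (a1 a2 : Attr)
    (t : int) (H : graph T) : Prop :=
  [/\ subgraph H G,
      min_enhanced_degree attr color a1 a2 t H
    & ~ exists H' : graph T,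
        [/\ subgraph H' G,
            min_enhanced_degree attr color a1 a2 t H'
          & proper_subgraph H H']].

(* Main.v *)
(** Whether [ED(u) >= t] depends only on the set [N] of neighbors of [u]: it
    says that [N] meets at least [t] colors at vertices of attribute [a1], at
    least [t] at vertices of attribute [a2], and at least [2 t] in all. This
    condition is monotone in [N], so the subgraphs of [G] satisfying it have a
    largest member, induced on the union of all vertex sets whose induced
    subgraph satisfies it. In a fair clique a vertex [u] has all the other
    vertices as neighbors and these have distinct colors, so the three numbers
    of colors are at least [k - 1], [k - 1] and [2 k - 1]. *)
Require Import Defs.
From HB Require Import structures.
From mathcomp Require Import all_boot all_order all_algebra.
From mathcomp Require Import zify.
Set Implicit Arguments.
Unset Strict Implicit.
Unset Printing Implicit Defensive.
Import Order.TTheory GRing.Theory Num.Theory.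
Local Open Scope ring_scope.

(** * Subgraph order and induced subgraphs *)

Section Graphs.
Variable T : finType.
Implicit Types (G H : graph T) (S : {set T}).

(** The field [edgesP] is a boolean equation, so any two proofs of it coincide. *)
Lemma graph_ext G H :
  vertices G = vertices H -> edges G = edges H -> G = H.
Proof.
by case: G H => V E p [V' E' p'] /= eV eE; case: _ / eV eE p p' => <- p p';
  rewrite (bool_irrelevance p p').
Qed.

Lemma subgraph_anti G H : subgraph G H -> subgraph H G -> G = H.
Proof.
move=> [sV sE] [sV' sE'].
by apply: graph_ext; apply/eqP; rewrite eqEsubset ?sV ?sV' ?sE ?sE'.
Qed.

Lemma adjacent_vertex G u v :
  adjacent G u v -> v \in vertices G.
Proof.
move=> uv; have /forall_inP/(_ _ uv)/andP[_ /subsetP] := edgesP G.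
by apply; rewrite set22.
Qed.

Lemma adjacent_irrefl G u : adjacent G u u = false.
Proof.
apply/negP => uu; have /forall_inP/(_ _ uu)/andP[] := edgesP G.
by rewrite setUid cards1.
Qed.

Lemma neighbors_sub G H u : subgraph G H -> neighbors G u \subset neighbors H u.
Proof. by case=> _ /subsetP sE; apply/subsetP => v; rewrite !inE => /sE. Qed.

Lemma induced_edgesP G S :
  [forall e in [set e in edges G | e \subset S],
     (#|e| == 2%N) && (e \subset vertices G :&: S)].
Proof.
apply/forall_inP => e; rewrite inE => /andP[eG eS].
have /forall_inP/(_ _ eG)/andP[-> eV] := edgesP G.
by rewrite subsetI eV.
Qed.

Definition induced G S : graph T := Graph (induced_edgesP G S).

Lemma induced_sub G S : subgraph (induced G S) G.
Proof. by split; [exact: subsetIl | apply/subsetP => e; rewrite inE => /andP[]]. Qed.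

Lemma sub_induced G H S :
  subgraph H G -> vertices H \subset S -> subgraph H (induced G S).
Proof.
move=> [sV sE] sS; split; first by rewrite subsetI sV.
apply/subsetP => e eH; rewrite inE (subsetP sE) //=.
have /forall_inP/(_ _ eH)/andP[_ eV] := edgesP H.
exact: subset_trans eV sS.
Qed.

End Graphs.

(** * Blocks of the color partition and numbers of colors *)

Section ColorCount.
Variables (T : finType) (Col : eqType) (color : T -> Col).
Implicit Types (S : {set T}) (P : pred T).

Definition color_class v : {set T} := [set w | color w == color v].

(* Colors are counted through their classes, since [Col] need not be finite. *)
Definition ncolors S : nat := #|color_class @: S|.

Lemma ncolorsS S S' : S \subset S' -> (ncolors S <= ncolors S')%N.
Proof. by move=> sS; apply/subset_leq_card/imsetS. Qed.

Lemma ncolors_inj S : {in S &, injective color} -> ncolors S = #|S|.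
Proof.
move=> inj; apply: card_in_imset => u v uS vS /setP/(_ u).
by rewrite !inE eqxx => /esym/eqP; apply: inj.
Qed.

(** The blocks in question are the traces on [S] of the color classes of the vertices of [S]
    satisfying [P]. *)
Lemma card_blocks_with S P :
  #|[set B in preim_partition color S | [exists v in B, P v]]|
    = ncolors [set v in S | P v].
Proof.
have -> : [set B in preim_partition color S | [exists v in B, P v]]
    = (fun X => S :&: X) @: (color_class @: [set v in S | P v]).
  rewrite -imset_comp; apply/setP => B; rewrite inE.
  apply/andP/imsetP => [[/imsetP[x xS ->] /exists_inP[v]]|[v]]; rewrite !inE.
    move=> /andP[vS /eqP xv] Pv; exists v; first by rewrite inE vS.
    by apply/setP => w; rewrite !inE xv [_ == color w]eq_sym.
  move=> /andP[vS Pv] ->; split; last first.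
    by apply/exists_inP; exists v; rewrite // !inE vS eqxx.
  by apply/imsetP; exists v => //; apply/setP => w; rewrite !inE eq_sym.
(* Taking the trace is injective on these classes: the trace of the class of [u] contains [u]
   itself, which fixes the color. *)
apply: card_in_imset => _ _ /imsetP[u + ->] /imsetP[v _ ->].
rewrite inE => /andP[uS _] /setP/(_ u); rewrite !inE uS eqxx /= => /esym/eqP uv.
by apply/setP => w; rewrite !inE uv.
Qed.

Lemma card_blocks S : #|preim_partition color S| = ncolors S.
Proof.
have /and3P[_ _ n0] := preim_partitionP color S.
have := card_blocks_with S predT.
have -> : [set v in S | predT v] = S by apply/setP => v; rewrite inE andbT.
move=> <-; apply/eq_card => B; rewrite !inE.
have [BP|//] := boolP (B \in _); apply/esym/exists_inP.
by have [B0|[v vB]] := set_0Vmem B; [rewrite -B0 BP in n0 | exists v].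
Qed.

End ColorCount.

(** * Enhanced colorful degree, its monotonicity and the largest subgraph *)

Section EnhancedDegree.
Variables (T : finType) (Attr Col : eqType) (attr : T -> Attr).
Variables (color : T -> Col) (a1 a2 : Attr).
Hypothesis a1_neq_a2 : a1 != a2.
Implicit Types (G H : graph T) (t : int).

(** Hall's condition for two attributes. Mixed groups can fill the gap [t - c1] iff [t <= c1 + cm],
    the number of groups meeting [a1]; likewise for [a2]; and both positive gaps iff
    [2 t <= c1 + c2 + cm], the number of all groups. If one gap is not positive, the last bound
    follows from the others. The greedy assignment loses nothing, as [a1] takes only what it
    lacks. *)
Lemma enhanced_colorful_degree_ge H u t :
    {in neighbors H u, forall v, (attr v == a1) || (attr v == a2)} ->
  (t <= enhanced_colorful_degree attr color a1 a2 t H u)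
    = [&& t <= (ncolors color [set v in neighbors H u | attr v == a1])%:Z,
          t <= (ncolors color [set v in neighbors H u | attr v == a2])%:Z
        & t *+ 2 <= (ncolors color (neighbors H u))%:Z].
Proof.
move=> attrN; set N := neighbors H u.
pose P := preim_partition color N.
pose E a := [set B in P | [exists v in B, attr v == a]].
have /and3P[/eqP covP _ n0] := preim_partitionP color N.
have attrB B v : B \in P -> v \in B -> (attr v == a1) || (attr v == a2).
  by move=> BP vB; apply: attrN; rewrite -/N -covP; apply/bigcupP; exists B.
(* With only two attributes around, being pure in one means not meeting the other. *)
have pureE a b : a != b ->
    {in N, forall v, (attr v == a) || (attr v == b)} ->
    pure_groups attr color H u a = #|P :\: E b|.
  move=> ab attrab; rewrite /pure_groups -/P; apply: eq_card => B.
  rewrite !inE /color_groups -/N -/P.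
  have [BP|] := boolP (B \in P); rewrite ?andbF //= andbT negb_exists_in.
  apply: eq_forallb_in => v vB.
  have /attrab : v \in N by rewrite -covP; apply/bigcupP; exists B.
  by case: (eqVneq (attr v) a) => [->|_ /= ->].
have mixedE : mixed_groups attr color H u a1 a2 = #|E a1 :&: E a2|.
  rewrite /mixed_groups; apply: eq_card => B; rewrite !inE /color_groups -/N -/P.
  by case: (B \in P).
have EU : E a1 :|: E a2 = P.
  apply/setP => B; rewrite !inE -andb_orr.
  have [BP|//] := boolP (B \in P).
  have [B0|[v vB]] := set_0Vmem B; first by rewrite -B0 BP in n0.
  by apply/orP; case/orP: (attrB _ _ BP vB) => va; [left|right];
    apply/exists_inP; exists v.
rewrite /enhanced_colorful_degree mixedE (pureE a1 a2) // (pureE a2 a1);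
  [|by rewrite eq_sym|by move=> v /attrN; rewrite orbC].
rewrite -!card_blocks_with -card_blocks -/N -/P -/(E a1) -/(E a2).
have s1 : E a1 \subset P by rewrite -EU subsetUl.
have s2 : E a2 \subset P by rewrite -EU subsetUr.
(* Inclusion-exclusion and the two differences express [c1], [c2], [cm] through the three numbers of
   colors; linear arithmetic does the rest. *)
have := cardsUI (E a1) (E a2); rewrite EU => cUI.
have c1 := cardsID (E a1) P; have c2 := cardsID (E a2) P.
move: c1 c2; rewrite (setIidPr s1) (setIidPr s2).
move: #|P| #|E a1| #|E a2| #|_ :\: E a1| #|_ :\: E a2| #|_ :&: _| cUI.
move=> p e1 e2 d1 d2 i cUI c1 c2.
by case: ifP; case: ifP; lia.
Qed.

(** New neighbors may turn pure groups into mixed ones, so [c1] and [c2] can drop, but the three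
    numbers of colors only grow. *)
Lemma enhanced_colorful_degreeS H H' u t :
    {in vertices H', forall v, (attr v == a1) || (attr v == a2)} ->
    subgraph H H' ->
    t <= enhanced_colorful_degree attr color a1 a2 t H u ->
  t <= enhanced_colorful_degree attr color a1 a2 t H' u.
Proof.
move=> attrH' sH; have sN := neighbors_sub u sH.
have attrN' : {in neighbors H' u, forall v, (attr v == a1) || (attr v == a2)}.
  by move=> v; rewrite inE => /adjacent_vertex/attrH'.
have attrN : {in neighbors H u, forall v, (attr v == a1) || (attr v == a2)}.
  by move=> v /(subsetP sN)/attrN'.
rewrite !enhanced_colorful_degree_ge // => /and3P[t1 t2 t12].
have sNa a : [set v in neighbors H u | attr v == a]
    \subset [set v in neighbors H' u | attr v == a].
  by apply/subsetP => v /setIdP[vN va]; apply/setIdP; rewrite (subsetP sN).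
by apply/and3P; split;
  [apply: le_trans t1 _|apply: le_trans t2 _|apply: le_trans t12 _];
  rewrite lez_nat ncolorsS.
Qed.

Lemma ex_maximum_min_enhanced_degree G t :
    {in vertices G, forall v, (attr v == a1) || (attr v == a2)} ->
  exists H, [/\ subgraph H G, min_enhanced_degree attr color a1 a2 t H
    & forall H', subgraph H' G -> min_enhanced_degree attr color a1 a2 t H' ->
        subgraph H' H].
Proof.
move=> attrG.
have attr_induced S :
    {in vertices (induced G S), forall v, (attr v == a1) || (attr v == a2)}.
  by move=> v /(subsetP (proj1 (induced_sub G S)))/attrG.
pose ok S := [forall u in vertices (induced G S),
  t <= enhanced_colorful_degree attr color a1 a2 t (induced G S) u].
pose U := \bigcup_(S | ok S) S.
exists (induced G U); split; first exact: induced_sub.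
- move=> u /setIP[uG /bigcupP[S okS uS]].
  apply: (@enhanced_colorful_degreeS (induced G S)) => //.
    apply: sub_induced; first exact: induced_sub.
    by apply: subset_trans (subsetIr _ _) _; apply: bigcup_sup okS.
  by apply: (forall_inP okS); rewrite inE uG.
(* [H'] need not be induced, but adding all edges of [G] between its vertices keeps the bound, so
   its vertex set is one of those united in [U]. *)
- move=> H' sH' degH'; apply: sub_induced => //; apply: bigcup_sup.
  apply/forall_inP => u /setIP[_ /degH']; apply: enhanced_colorful_degreeS => //.
  exact: sub_induced.
Qed.

Lemma fair_clique_min_enhanced_degree G C (k : int) :
    proper_coloring G color ->
    {in vertices G, forall v, (attr v == a1) || (attr v == a2)} ->
    clique G C -> k <= (cnt attr C a1)%:Z -> k <= (cnt attr C a2)%:Z ->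
  min_enhanced_degree attr color a1 a2 (k - 1) C.
Proof.
move=> colG attrG [sCG adjC] k1 k2 u uC.
have attrC : {in vertices C, forall v, (attr v == a1) || (attr v == a2)}.
  by move=> v /(subsetP (proj1 sCG))/attrG.
have NE : neighbors C u = vertices C :\ u.
  apply/setP => v; rewrite !inE; apply/idP/andP => [uv|[vu vC]].
    rewrite (adjacent_vertex uv); split=> //.
    by apply: contraTneq uv => ->; rewrite adjacent_irrefl.
  by apply: adjC; rewrite // eq_sym.
have colC : {in vertices C &, injective color}.
  move=> v w vC wC cvw; apply/eqP/negPn/negP => /(adjC v w vC wC) vw.
  have /(colG v w) : adjacent G v w by apply: (subsetP (proj2 sCG)).
  by rewrite cvw eqxx.
have ncolE (S : {set T}) : S \subset vertices C -> ncolors color S = #|S|.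
  by move=> /subsetP sS; apply: ncolors_inj => v w /sS vC /sS wC; apply: colC.
rewrite enhanced_colorful_degree_ge; last first.
  by move=> v; rewrite inE => /adjacent_vertex/attrC.
rewrite NE !ncolE; first last.
- by apply/subsetP => v; rewrite !inE => /andP[/andP[]].
- by apply/subsetP => v; rewrite !inE => /andP[/andP[]].
- exact: subsetDl.
(* Removing [u] costs either attribute at most one vertex. *)
have cntE a : (cnt attr C a
    <= #|[set v in vertices C :\ u | attr v == a]|.+1)%N.
  rewrite /cnt (cardsD1 u) -add1n; apply: leq_add; first exact: leq_b1.
  by apply/subset_leq_card/subsetP => v; rewrite !inE andbA.
(* The total is at least [2 k], so without [u] there remain [2 k - 1] vertices, enough for
   [2 (k - 1)]. *)
have cardC : #|vertices C| = (cnt attr C a1 + cnt attr C a2)%N.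
  rewrite /cnt -(cardsID [set v | attr v == a1]).
  congr (_ + _)%N; apply: eq_card => v; rewrite !inE // andbC.
  have [/attrC|//] := boolP (v \in vertices C).
  by case: (eqVneq (attr v) a1) => [->|_ /= ->] //=; rewrite (negPf a1_neq_a2).
have := cardsD1 u (vertices C); rewrite uC cardC => cardCu.
have := cntE a1; have := cntE a2.
by move: #|[set v in _ | attr v == a1]| #|[set v in _ | attr v == a2]|; lia.
Qed.

End EnhancedDegree.

Theorem lemma3 (T : finType) (Attr Col : eqType) (G : graph T)
    (attr : T -> Attr) (color : T -> Col) (a1 a2 : Attr) (k delta : int)
    (hcolor : proper_coloring G color)
    (ha : a1 != a2)
    (hval : attribute_values G attr =i [:: a1; a2]) :
  exists H : graph T,
    unique (enhanced_colorful_core G attr color a1 a2 (k - 1)) H /\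
    forall C : graph T, relative_fair_clique G attr k delta C -> subgraph C H.
Proof.
have attrG : {in vertices G, forall v, (attr v == a1) || (attr v == a2)}.
  by move=> v vG; have := hval (attr v); rewrite image_f // !inE => <-.
have [H [sHG degH maxH]] :=
  ex_maximum_min_enhanced_degree color ha (k - 1) attrG.
exists H; split; [split|].
- split=> // -[H' [sH'G degH' [sHH']]]; apply.
  exact: subgraph_anti sHH' (maxH _ sH'G degH').
(* Another core lies in [H]; if it differed in vertices or in edges, [H] would contradict its
   maximality. *)
- move=> H' [sH'G degH' maxH']; have [sV sE] := maxH _ sH'G degH'.
  have [/eqP eV|neV] := boolP (vertices H == vertices H'); last first.
    by case: maxH'; exists H; split=> //; split=> // eH; rewrite eH eqxx in neV.
  have [/eqP eE|neE] := boolP (edges H == edges H'); last first.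
    by case: maxH'; exists H; split=> //; split=> // eH; rewrite eH eqxx in neE.
  exact: graph_ext.
- move=> C [clC [fairC _] _]; apply: maxH; first by case: clC.
  by apply: fair_clique_min_enhanced_degree clC _ _ => //; apply: fairC;
    rewrite hval !inE eqxx ?orbT.
Qed.
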